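(* Let $T$ be a tensor minimal over $X,Y,Z$, and let $X=X_1\cup\dots\cup X_{k_X}$, $Y=Y_1\cup\dots\cup Y_{k_Y}$, $Z=Z_1\cup\dots\cup Z_{k_Z}$ be any partitions of its variable sets. Then $\tilde S(T)\le\sup_{p\in P(L)}\min\{p_X,p_Y,p_Z\}$.
   Context: Tensors over a field $\mathbb{F}$; a tensor over finite variable sets $X,Y,Z$ is a trilinear form $\sum\alpha_{xyz}xyz$, minimal if every variable appears in a term with nonzero coefficient. Tensor powers $T^{\otimes n}$ are over $X^n,Y^n,Z^n$. Slice rank: $T$ has x-rank 1 if $T=(\sum\alpha_xx)\otimes(\sum\beta_{yz}yz)$; $S_x(T)$ is the least number of x-rank-1 summands, $S_y,S_z$ analogously; $S(T)=\min\{S_x(T_X)+S_y(T_Y)+S_z(T_Z):T=T_X+T_Y+T_Z\}$; $\tilde S(T)=\limsup_nS(T^{\otimes n})^{1/n}$. Partition notation: $T_{ijk}$ is $T$ with all variables outside $X_i\cup Y_j\cup Z_k$ set to zero; $L=\{T_{ijk}:T_{ijk}\ne0\}$ (indexed by the triples $(i,j,k)$); $P(L)$ is the set of probability distributions on $L$. For $p\in P(L)$, $p(X_i)=\sum_{(j,k):T_{ijk}\in L}p(T_{ijk})$, similarly $p(Y_j),p(Z_k)$, and $p_X=\prod_{i\in[k_X]}(|X_i|/p(X_i))^{p(X_i)}$, with $p_Y,p_Z$ defined analogously, using the convention that a factor with $p(X_i)=0$ equals $1$. *)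

(* Defs.v *)
From HB Require Import structures.
From mathcomp Require Export all_boot all_order all_algebra.
From mathcomp Require Export all_classical all_reals all_analysis.
Set Implicit Arguments.
Unset Strict Implicit.
Unset Printing Implicit Defensive.
Import Order.TTheory GRing.Theory Num.Theory.
Local Open Scope ring_scope.

(* The trilinear form \sum alpha_{xyz} x y z is given by its coefficients;
   u : X * Y * Z is the triple (u.1.1, u.1.2, u.2). *)
Notation tensor F X Y Z := {ffun (X * Y * Z)%type -> F}.

Definition minimal_tensor (F : fieldType) (X Y Z : finType) (T : tensor F X Y Z) : Prop :=
  [/\ forall x, exists y z, T (x, y, z) != 0,
      forall y, exists x z, T (x, y, z) != 0 &
      forall z, exists x y, T (x, y, z) != 0].

Definition tensor_pow (F : fieldType) (X Y Z : finType) (T : tensor F X Y Z)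
    (n : nat) :
    tensor F {ffun 'I_n -> X} {ffun 'I_n -> Y} {ffun 'I_n -> Z} :=
  [ffun u : {ffun 'I_n -> X} * {ffun 'I_n -> Y} * {ffun 'I_n -> Z} =>
     \prod_(i < n) T (u.1.1 i, u.1.2 i, u.2 i)].

Section SliceRank.
Variables (F : fieldType) (X Y Z : finType).
Implicit Types (T : tensor F X Y Z) (r : nat).

Definition x_rank1 T : Prop :=
  exists (a : X -> F) (b : Y -> Z -> F),
    T = [ffun u => a u.1.1 * b u.1.2 u.2].

Definition y_rank1 T : Prop :=
  exists (a : Y -> F) (b : X -> Z -> F),
    T = [ffun u => a u.1.2 * b u.1.1 u.2].

Definition z_rank1 T : Prop :=
  exists (a : Z -> F) (b : X -> Y -> F),
    T = [ffun u => a u.2 * b u.1.1 u.1.2].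

Definition sum_of (rank1 : tensor F X Y Z -> Prop) T r : Prop :=
  exists t : 'I_r -> tensor F X Y Z,
    (forall i, rank1 (t i)) /\ T = \sum_(i < r) t i.

Lemma sum_of_x_exists T : exists r, `[< sum_of x_rank1 T r >].
Proof.
exists #|X|; apply/asboolP.
exists (fun i => [ffun u => (u.1.1 == enum_val i)%:R *
                            T (enum_val i, u.1.2, u.2)]); split.
  by move=> i; exists (fun x => (x == enum_val i)%:R),
                      (fun y z => T (enum_val i, y, z)).
apply/ffunP => -[[x y] z]; rewrite sum_ffunE (bigD1 (enum_rank x)) //=.
rewrite ffunE /= enum_rankK eqxx mul1r big1 ?addr0 // => i ne_i.
rewrite ffunE /=; case: eqP => [xE|_]; last by rewrite mul0r.
by rewrite xE enum_valK eqxx in ne_i.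
Qed.

Lemma sum_of_y_exists T : exists r, `[< sum_of y_rank1 T r >].
Proof.
exists #|Y|; apply/asboolP.
exists (fun i => [ffun u => (u.1.2 == enum_val i)%:R *
                            T (u.1.1, enum_val i, u.2)]); split.
  by move=> i; exists (fun y => (y == enum_val i)%:R),
                      (fun x z => T (x, enum_val i, z)).
apply/ffunP => -[[x y] z]; rewrite sum_ffunE (bigD1 (enum_rank y)) //=.
rewrite ffunE /= enum_rankK eqxx mul1r big1 ?addr0 // => i ne_i.
rewrite ffunE /=; case: eqP => [yE|_]; last by rewrite mul0r.
by rewrite yE enum_valK eqxx in ne_i.
Qed.

Lemma sum_of_z_exists T : exists r, `[< sum_of z_rank1 T r >].
Proof.
exists #|Z|; apply/asboolP.
exists (fun i => [ffun u => (u.2 == enum_val i)%:R *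
                            T (u.1.1, u.1.2, enum_val i)]); split.
  by move=> i; exists (fun z => (z == enum_val i)%:R),
                      (fun x y => T (x, y, enum_val i)).
apply/ffunP => -[[x y] z]; rewrite sum_ffunE (bigD1 (enum_rank z)) //=.
rewrite ffunE /= enum_rankK eqxx mul1r big1 ?addr0 // => i ne_i.
rewrite ffunE /=; case: eqP => [zE|_]; last by rewrite mul0r.
by rewrite zE enum_valK eqxx in ne_i.
Qed.

Definition Sx T : nat := ex_minn (sum_of_x_exists T).
Definition Sy T : nat := ex_minn (sum_of_y_exists T).
Definition Sz T : nat := ex_minn (sum_of_z_exists T).

Definition slice_decomposition T r : Prop :=
  exists TX TY TZ : tensor F X Y Z,
    T = TX + TY + TZ /\ r = (Sx TX + Sy TY + Sz TZ)%N.

Lemma slice_decomposition_exists T : exists r, `[< slice_decomposition T r >].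
Proof.
exists (Sx T + Sy 0%R + Sz 0%R)%N; apply/asboolP.
by exists T, 0, 0; rewrite !addr0.
Qed.

Definition slice_rank T : nat := ex_minn (slice_decomposition_exists T).

End SliceRank.

(* The limsup is taken in \bar R, so that no boundedness side condition is
   involved; the value at the index n = 0 is irrelevant. *)
Definition asymptotic_slice_rank (R : realType) (F : fieldType)
    (X Y Z : finType) (T : tensor F X Y Z) : \bar R :=
  limn_esup (fun n : nat =>
    (((slice_rank (tensor_pow T n))%:R : R) `^ (n%:R^-1))%:E).

Definition is_indexed_partition (X : finType) (k : nat) (P : 'I_k -> {set X}) : Prop :=
  injective P /\ finset.partition (P @: [set: 'I_k])%SET [set: X]%SET.

Section Blocks.
Variables (R : realType) (F : fieldType) (X Y Z : finType) (kX kY kZ : nat).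
Variables (PX : 'I_kX -> {set X}) (PY : 'I_kY -> {set Y}) (PZ : 'I_kZ -> {set Z}).
Variable (T : tensor F X Y Z).

Definition block (i : 'I_kX) (j : 'I_kY) (k : 'I_kZ) : tensor F X Y Z :=
  [ffun u => if [&& u.1.1 \in PX i, u.1.2 \in PY j & u.2 \in PZ k]
             then T u else 0].

Definition L : {set 'I_kX * 'I_kY * 'I_kZ} :=
  [set u | block u.1.1 u.1.2 u.2 != 0]%SET.

(* A distribution on L is a function on all index triples vanishing off L. *)
Definition distribution_on_L (p : 'I_kX * 'I_kY * 'I_kZ -> R) : Prop :=
  [/\ forall u, 0 <= p u, forall u, u \notin L -> p u = 0 &
      \sum_(u in L) p u = 1].

Variable p : 'I_kX * 'I_kY * 'I_kZ -> R.

Definition margX (i : 'I_kX) : R :=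
  \sum_(v : 'I_kY * 'I_kZ | (i, v.1, v.2) \in L) p (i, v.1, v.2).
Definition margY (j : 'I_kY) : R :=
  \sum_(v : 'I_kX * 'I_kZ | (v.1, j, v.2) \in L) p (v.1, j, v.2).
Definition margZ (k : 'I_kZ) : R :=
  \sum_(v : 'I_kX * 'I_kY | (v.1, v.2, k) \in L) p (v.1, v.2, k).

(* a `^ 0 = 1 for every a, so a block of marginal 0 contributes the factor 1. *)
Definition pX : R := \prod_(i < kX) (#|PX i|%:R / margX i) `^ margX i.
Definition pY : R := \prod_(j < kY) (#|PY j|%:R / margY j) `^ margY j.
Definition pZ : R := \prod_(k < kZ) (#|PZ k|%:R / margZ k) `^ margZ k.

End Blocks.

Definition min_values (R : realType) (F : fieldType) (X Y Z : finType)
    (kX kY kZ : nat) (PX : 'I_kX -> {set X}) (PY : 'I_kY -> {set Y})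
    (PZ : 'I_kZ -> {set Z}) (T : tensor F X Y Z) : set R :=
  [set Num.min (pX PX PY PZ T p) (Num.min (pY PX PY PZ T p) (pZ PX PY PZ T p))
    | p in distribution_on_L (R := R) PX PY PZ T]%classic.

(* Since this set is bounded above, its real [sup] is its least upper bound unless it is empty,
   i.e. unless T = 0; there [sup] is 0, the supremum of the empty subset of the
   nonnegative reals. *)
Lemma min_values_ubound (R : realType) (F : fieldType) (X Y Z : finType)
    (kX kY kZ : nat) (PX : 'I_kX -> {set X}) (PY : 'I_kY -> {set Y})
    (PZ : 'I_kZ -> {set Z}) (T : tensor F X Y Z) :
  has_ubound (min_values (R := R) PX PY PZ T).
Proof.
exists (\prod_(i < kX) expR (#|PX i|%:R + 1)) => _ [p [p0 _ _] <-].
rewrite ge_min; apply/orP; left; apply: ler_prod => i _.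
rewrite powR_ge0 /=; set m := margX _ _ _ _ _ _.
have m0 : 0 <= m by apply: sumr_ge0.
rewrite /powR; case: ifPn => [_|a0].
  case: (m == 0) => /=; last exact: expR_ge0.
  by rewrite -expR0 ler_expR addr_ge0.
rewrite ler_expR.
have mn0 : m != 0 by apply: contraNneq a0 => ->; rewrite invr0 mulr0.
have mgt0 : 0 < m by rewrite lt_neqAle eq_sym mn0.
have agt0 : 0 < #|PX i|%:R / m by rewrite lt_neqAle eq_sym a0 divr_ge0.
apply: (le_trans (ler_wpM2l m0 (ltW (ln_sublinear agt0)))).
by rewrite mulrC divfK // lerDl.
Qed.

(* Main.v *)
(* A triple (x, y, z) in the support of T^n determines a word of n blocks of L,
   and the frequencies of the blocks in that word form a distribution p on L.
   The block frequencies of x, y and z are then the marginals of p, so that x, y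
   and z lie in type classes of at most p_X^n, p_Y^n and p_Z^n elements; the
   smallest of the three has at most s^n elements, s being the supremum.  Since
   there are at most (n+1)^K types, the support of T^n is covered by at most
   3 (n+1)^K s^n slices, and the polynomial factor disappears in the n-th root. *)
Require Import Defs.
Set Implicit Arguments.
Unset Strict Implicit.
Unset Printing Implicit Defensive.
Import Order.TTheory GRing.Theory Num.Theory.
Local Open Scope ring_scope.

(** * Slice rank bounded by covers of the support *)

Lemma sum_indicator_enum (V : pzRingType) (I : finType) (A : {set I}) (f : I -> V) x :
    (f x != 0 -> x \in A) ->
  \sum_(i < #|A|) (x == enum_val i)%:R * f (enum_val i) = f x.
Proof.
move=> fA; rewrite -(big_enum_val (fun i => (x == i)%:R * f i)) /=.
have [xA|xA] := boolP (x \in A).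
  rewrite (bigD1 x) //= eqxx mul1r big1 ?addr0 // => i /andP[_].
  by rewrite eq_sym => /negPf ->; rewrite mul0r.
rewrite big1 => [|i iA]; first by apply/esym/eqP/negPn; apply: contra xA => /fA.
by case: eqP => [xi|_]; [rewrite xi iA in xA | rewrite mul0r].
Qed.

Section SliceCover.
Variables (F : fieldType) (X Y Z : finType).
Implicit Types (T : tensor F X Y Z) (A : {set X}) (B : {set Y}) (C : {set Z}).

(** [T] is the sum of its slices at the elements of [A], each an indicator in x times a form in y
    and z; off [A] both sides vanish. *)
Lemma Sx_le_card T A :
  (forall u, T u != 0 -> u.1.1 \in A) -> (Sx T <= #|A|)%N.
Proof.
move=> TA; rewrite /Sx; case: ex_minnP => m _; apply; apply/asboolP.
exists (fun i => [ffun u => (u.1.1 == enum_val i)%:R *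
                            T (enum_val i, u.1.2, u.2)]); split.
  by move=> i; exists (fun x => (x == enum_val i)%:R),
                      (fun y z => T (enum_val i, y, z)).
apply/ffunP => -[[x y] z]; rewrite sum_ffunE.
rewrite -[LHS](sum_indicator_enum (A := A) (f := fun x => T (x, y, z))); last exact: TA (x, y, z).
by apply: eq_bigr => i _; rewrite ffunE.
Qed.

Lemma Sy_le_card T B :
  (forall u, T u != 0 -> u.1.2 \in B) -> (Sy T <= #|B|)%N.
Proof.
move=> TB; rewrite /Sy; case: ex_minnP => m _; apply; apply/asboolP.
exists (fun i => [ffun u => (u.1.2 == enum_val i)%:R *
                            T (u.1.1, enum_val i, u.2)]); split.
  by move=> i; exists (fun y => (y == enum_val i)%:R),
                      (fun x z => T (x, enum_val i, z)).
apply/ffunP => -[[x y] z]; rewrite sum_ffunE.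
rewrite -[LHS](sum_indicator_enum (A := B) (f := fun y => T (x, y, z))); last exact: TB (x, y, z).
by apply: eq_bigr => i _; rewrite ffunE.
Qed.

Lemma Sz_le_card T C :
  (forall u, T u != 0 -> u.2 \in C) -> (Sz T <= #|C|)%N.
Proof.
move=> TC; rewrite /Sz; case: ex_minnP => m _; apply; apply/asboolP.
exists (fun i => [ffun u => (u.2 == enum_val i)%:R *
                            T (u.1.1, u.1.2, enum_val i)]); split.
  by move=> i; exists (fun z => (z == enum_val i)%:R),
                      (fun x y => T (x, y, enum_val i)).
apply/ffunP => -[[x y] z]; rewrite sum_ffunE.
rewrite -[LHS](sum_indicator_enum (A := C) (f := fun z => T (x, y, z))); last exact: TC (x, y, z).
by apply: eq_bigr => i _; rewrite ffunE.
Qed.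

(** Each support entry goes to the first of [A], [B], [C] that contains its coordinate, which splits
    [T] into three tensors without double counting. *)
Lemma slice_rank_le_cover T A B C :
    (forall u, T u != 0 -> [|| u.1.1 \in A, u.1.2 \in B | u.2 \in C]) ->
  (slice_rank T <= #|A| + #|B| + #|C|)%N.
Proof.
move=> TABC.
pose TX : tensor F X Y Z := [ffun u => if u.1.1 \in A then T u else 0].
pose TY : tensor F X Y Z :=
  [ffun u => if (u.1.1 \notin A) && (u.1.2 \in B) then T u else 0].
pose TZ : tensor F X Y Z :=
  [ffun u => if (u.1.1 \notin A) && (u.1.2 \notin B) then T u else 0].
apply: (@leq_trans (Sx TX + Sy TY + Sz TZ)).
  rewrite /slice_rank; case: ex_minnP => m _; apply; apply/asboolP.
  exists TX, TY, TZ; split=> //; apply/ffunP => u; rewrite !ffunE.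
  by do 2 case: (_ \in _); rewrite /= ?addr0 ?add0r.
rewrite !leq_add //.
- by apply: Sx_le_card => u; rewrite ffunE; case: ifP; rewrite ?eqxx.
- by apply: Sy_le_card => u; rewrite ffunE; case: ifP => [/andP[]|]; rewrite ?eqxx.
- apply: Sz_le_card => u; rewrite ffunE; case: ifP; rewrite ?eqxx //.
  by case/andP => /negPf uA /negPf uB /TABC; rewrite uA uB.
Qed.

End SliceCover.

(** * Sizes of type classes *)

Lemma card_fiber (I J : finType) (g : I -> J) (A : {set I}) :
  #|A| = (\sum_j #|[set t in A | g t == j]%SET|)%N.
Proof.
rewrite -sum1_card (partition_big g xpredT) //=; apply: eq_bigr => j _.
by rewrite -sum1_card; apply: eq_bigl => t; rewrite inE.
Qed.

Section Types.
Variables (X I : finType) (b : X -> I) (n : nat).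
Implicit Types (x : {ffun 'I_n -> X}) (m : I -> nat).

Definition type_class m : {set {ffun 'I_n -> X}} :=
  [set x : {ffun 'I_n -> X} | [forall i, #|[set t | b (x t) == i]%SET| == m i]]%SET.

(* Give the letter [x] the probability [q_(b x) / c_(b x)], where [q = m / n] and
   [c_i] is the size of the fibre of [i]: all words of type [m] then have the
   same probability, the inverse of the right-hand side. *)
Lemma card_type_class (R : realType) m : (0 < n)%N ->
  #|type_class m|%:R <=
    (\prod_i (#|[set x | b x == i]%SET|%:R / ((m i)%:R / n%:R)) `^
       ((m i)%:R / n%:R)) ^+ n :> R.
Proof.
move=> n0; set rhs := _ ^+ n.
have rhs0 : 0 <= rhs by apply/exprn_ge0/prodr_ge0 => i _; exact: powR_ge0.
(* The bound is trivial for an empty class; otherwise a word [x0] of type [m] forces the counts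
   [m i] to add up to [n], so that [q] is a distribution. *)
have [->|[x0 x0m]] := set_0Vmem (type_class m); first by rewrite cards0.
have n0R : n%:R != 0 :> R by rewrite pnatr_eq0 -lt0n.
pose q i : R := (m i)%:R / n%:R.
pose c i : R := #|[set x | b x == i]%SET|%:R.
have q0 i : 0 <= q i by rewrite divr_ge0.
have c0 i : 0 <= c i by [].
have sumq : \sum_i q i = 1.
  rewrite -mulr_suml -natr_sum (_ : (\sum_i m i)%N = n) ?divff //.
  rewrite -[RHS]card_ord -sum1_card (partition_big (fun t => b (x0 t)) xpredT) //=.
  apply: eq_bigr => i _; move: x0m; rewrite inE => /forallP/(_ i)/eqP <-.
  by rewrite -sum1_card; apply: eq_bigl => t; rewrite inE.
pose w (x : {ffun 'I_n -> X}) := \prod_t (q (b (x t)) / c (b (x t))).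
have w0 x : 0 <= w x by apply: prodr_ge0 => t _; rewrite divr_ge0.
have sumw : \sum_x w x <= 1.
  rewrite -(bigA_distr_bigA (fun (_ : 'I_n) (x : X) => q (b x) / c (b x))) /=.
  rewrite prodr_const card_ord exprn_ile1 //.
    by apply: sumr_ge0 => x _; rewrite divr_ge0.
  rewrite (partition_big b xpredT) //= -sumq; apply: ler_sum => i _.
  rewrite (eq_bigr (fun=> q i / c i)) => [|x /eqP -> //].
  rewrite sumr_const (_ : #|_| = #|[set x | b x == i]%SET|); last by rewrite cardsE.
  (* The letters over [i] have total weight [q i], or 0 if the fibre is empty; an inequality is
     enough. *)
  rewrite -mulr_natr -/(c i); have [->|ci] := eqVneq (c i) 0; rewrite ?mulr0 //.
  by rewrite divfK.
have wE x : x \in type_class m -> w x * rhs = 1.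
  rewrite inE => /forallP xm.
  rewrite /w (partition_big (fun t => b (x t)) xpredT) //= /rhs -prodrXl.
  rewrite -big_split big1 //= => i _.
  rewrite (eq_bigr (fun=> q i / c i)) => [|t /eqP -> //].
  rewrite prodr_const (_ : #|_| = m i); last first.
    by rewrite -(eqP (xm i)) cardsE.
  rewrite -[X in _ * X]powR_mulrn ?powR_ge0 // -powRrM divfK //.
  rewrite -/(c i) -/(q i) powR_mulrn ?divr_ge0 // -exprMn.
  (* A block that does not occur in [x] gives the empty power 1. Otherwise [q i] and [c i] are
     nonzero and the two ratios cancel. *)
  have [->|mi] := eqVneq (m i) 0%N; first by rewrite expr0.
  have qi : q i != 0 by rewrite mulf_neq0 ?invr_eq0 // pnatr_eq0.
  have ci : c i != 0.
    rewrite pnatr_eq0 cards_eq0; apply/set0Pn.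
    move: mi; rewrite -(eqP (xm i)) cards_eq0 => /set0Pn[t]; rewrite inE => bt.
    by exists (x t); rewrite inE.
  by rewrite mulrA divfK // divff // expr1n.
rewrite -[_%:R]mul1r.
have -> : 1 * #|type_class m|%:R = \sum_(x in type_class m) (w x * rhs).
  by rewrite (eq_bigr (fun=> 1)) // sumr_const mul1r.
rewrite -mulr_suml -[leRHS]mul1r ler_wpM2r // (le_trans _ sumw) //.
by rewrite [leRHS](bigID (mem (type_class m))) /= lerDl sumr_ge0.
Qed.

End Types.

(** Covering gives each point a block and disjointness makes that block unique as a set; injectivity
    of [P] then makes its index unique. *)
Lemma partition_index (X : finType) k (P : 'I_k -> {set X}) :
  is_indexed_partition P -> exists b : X -> 'I_k, forall x i, (x \in P i) = (b x == i).
Proof.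
move=> [injP /and3P[/eqP coverP trivP _]].
have ex x : {i | x \in P i}.
  apply/sigW; have : x \in finset.cover (P @: [set: 'I_k])%SET by rewrite coverP inE.
  by case/finset.bigcupP => _ /imsetP[i _ ->] xi; exists i.
exists (fun x => sval (ex x)) => x i.
apply/idP/eqP => [xi|<-]; last exact: (svalP (ex x)).
have PI j : P j \in (P @: [set: 'I_k])%SET by apply/imsetP; exists j; rewrite ?inE.
apply: injP; rewrite -(def_pblock trivP (PI i) xi).
by rewrite -(def_pblock trivP (PI _) (svalP (ex x))).
Qed.

(** * Polynomial factors under n-th roots *)

Section RootGrowth.
Variable R : realType.
Local Open Scope classical_set_scope.

(** The term of degree [K.+1] in the exponential series at [a * n.+1] is [D * n.+1%:R ^+ K.+1]; it
    exceeds [C * expR a * n.+1%:R ^+ K] once [n] is at least [C * expR a / D]. *)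
Lemma polynomial_le_exponential (C a : R) K : 0 < a ->
  \forall n \near \oo, C * n.+1%:R ^+ K <= expR a ^+ n.
Proof.
move=> a0; pose D := a ^+ K.+1 / K.+1`!%:R.
have D0 : 0 < D by rewrite divr_gt0 ?exprn_gt0 // ltr0n fact_gt0.
have le_exp (n : nat) : D * n.+1%:R ^+ K.+1 <= expR a * expR a ^+ n.
  rewrite -exprS -expRM_natr.
  have := expR_ge1Dxn K (mulr_ge0 (ltW a0) (ler0n R n.+1)).
  by apply: le_trans; rewrite exprMn mulrAC lerDr.
near=> n.
rewrite -(ler_pM2l (expR_gt0 a)) (le_trans _ (le_exp n)) //.
rewrite exprS !mulrA ler_wpM2r ?exprn_ge0 //.
rewrite mulrC -ler_pdivrMl // mulrC.
apply: (@le_trans _ _ n%:R); last by rewrite ler_nat.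
by near: n; exact: nbhs_infty_ger.
Unshelve. all: by end_near. Qed.

Lemma limn_esup_root_le (u : R^nat) (s C : R) K : 0 <= s -> (forall n, 0 <= u n) ->
    (forall n, (0 < n)%N -> u n <= C * n.+1%:R ^+ K * s ^+ n) ->
  (limn_esup (fun n => (u n `^ n%:R^-1)%:E) <= s%:E)%E.
Proof.
move=> s0 u0 u_le; apply/lee_addgt0Pr => e e0; rewrite -EFinD.
(* The factor [q > 1] absorbs the polynomial while [q * s] stays below [s + e]; the denominator
   [s + 1] is positive even when [s = 0]. *)
pose q := 1 + e / (s + 1).
have s1 : 0 < s + 1 by rewrite ltr_wpDl.
have q1 : 1 < q by rewrite ltrDl divr_gt0.
have q0 : 0 < q by rewrite (lt_trans _ q1).
have qs : q * s <= s + e.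
  rewrite mulrDl mul1r lerD2l mulrAC ler_pdivrMr // ler_pM2l //.
  by rewrite lerDl.
(* The limsup is an infimum of suprema over neighbourhoods of infinity, so one is enough: the
   positive [n] at which [q ^+ n] dominates the polynomial. *)
rewrite /limn_esup limf_esupE; apply: ge_ereal_inf.
exists (ereal_sup [set (u n `^ n%:R^-1)%:E | n in
    [set n | (0 < n)%N /\ C * n.+1%:R ^+ K <= expR (ln q) ^+ n]]).
  eexists; last by [].
  apply: filterI; first exact: nbhs_infty_gt.
  by apply: polynomial_le_exponential; rewrite ln_gt0.
apply: ge_ereal_sup => _ [n [n0 Cn] <-]; rewrite lee_fin (le_trans _ qs) //.
have qs0 : 0 <= q * s by rewrite mulr_ge0 // ltW.
have -> : q * s = ((q * s) ^+ n) `^ n%:R^-1.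
  by rewrite -powR_mulrn // -powRrM divff ?powRr1 // pnatr_eq0 -lt0n.
rewrite ge0_ler_powR ?invr_ge0 ?nnegrE ?exprn_ge0 //.
rewrite (le_trans (u_le n n0)) // exprMn ler_wpM2r ?exprn_ge0 //.
by rewrite lnK // in Cn.
Qed.

End RootGrowth.

Lemma sup_min_values_ge0 (R : realType) (F : fieldType) (X Y Z : finType)
    (kX kY kZ : nat) (PX : 'I_kX -> {set X}) (PY : 'I_kY -> {set Y})
    (PZ : 'I_kZ -> {set Z}) (T : tensor F X Y Z) :
  0 <= sup (min_values (R := R) PX PY PZ T).
Proof.
have [->|/set0P[r rM]] := eqVneq (min_values (R := R) PX PY PZ T) classical_sets.set0.
  by rewrite sup0.
apply: le_trans (ub_le_sup (min_values_ubound R PX PY PZ T) rM).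
case: rM => p _ <-; rewrite !le_min.
by apply/and3P; split; apply: prodr_ge0 => i _; exact: powR_ge0.
Qed.

(** * Block types and the slice rank of tensor powers *)

Section SliceRankPower.
Variables (R : realType) (F : fieldType) (X Y Z : finType) (T : tensor F X Y Z).
Variables (kX kY kZ : nat).
Variables (PX : 'I_kX -> {set X}) (PY : 'I_kY -> {set Y}) (PZ : 'I_kZ -> {set Z}).
Variables (bX : X -> 'I_kX) (bY : Y -> 'I_kY) (bZ : Z -> 'I_kZ).
Hypotheses (PXE : forall x i, (x \in PX i) = (bX x == i))
  (PYE : forall y j, (y \in PY j) = (bY y == j))
  (PZE : forall z k, (z \in PZ k) = (bZ z == k)).

Let I := ('I_kX * 'I_kY * 'I_kZ)%type.

Let L := L PX PY PZ T.

Lemma mem_L x y z : T (x, y, z) != 0 -> (bX x, bY y, bZ z) \in L.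
Proof.
move=> Txyz; rewrite inE; apply: contraNneq Txyz => /ffunP/(_ (x, y, z)).
by rewrite !ffunE /= PXE PYE PZE !eqxx /= => ->.
Qed.

Variable n : nat.
Hypothesis n_gt0 : (0 < n)%N.
Implicit Types tau : {ffun I -> 'I_n.+1}.

(** Counts are at most [n], so [inord] loses nothing, and values in ['I_n.+1] leave only (n+1)^(kX
    kY kZ) types. *)
Definition block_type_of (x : 'I_n -> X) (y : 'I_n -> Y) (z : 'I_n -> Z) :
    {ffun I -> 'I_n.+1} :=
  [ffun l => inord #|[set t | (bX (x t), bY (y t), bZ (z t)) == l]%SET|].

(** Unlike [margX], the sum is not restricted to [L]; the two agree up to the factor [n] for types
    that vanish off [L]. *)
Definition typeX tau (i : 'I_kX) : nat :=
  (\sum_(v : 'I_kY * 'I_kZ) tau (i, v.1, v.2))%N.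
Definition typeY tau (j : 'I_kY) : nat :=
  (\sum_(v : 'I_kX * 'I_kZ) tau (v.1, j, v.2))%N.
Definition typeZ tau (k : 'I_kZ) : nat :=
  (\sum_(v : 'I_kX * 'I_kY) tau (v.1, v.2, k))%N.

Definition type_on_L tau : bool :=
  [forall l, (l \notin L) ==> (tau l == 0 :> nat)] && ((\sum_l tau l)%N == n).

Definition type_distribution tau (l : I) : R := (tau l : nat)%:R / n%:R.

Lemma type_distributionP tau : type_on_L tau ->
  distribution_on_L PX PY PZ T (type_distribution tau).
Proof.
case/andP => /forallP tauL /eqP tau_sum; split.
- by move=> l; rewrite divr_ge0.
- by move=> l /(implyP (tauL l))/eqP tau0; rewrite /type_distribution tau0 mul0r.
rewrite -mulr_suml -natr_sum -[X in (X)%:R / _](_ : (\sum_l tau l)%N = _).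
  by rewrite tau_sum divff // pnatr_eq0 -lt0n.
rewrite (bigID (mem L)) /= [X in (_ + X)%N]big1 ?addn0 //.
by move=> l /(implyP (tauL l))/eqP.
Qed.

Lemma margX_type tau i : type_on_L tau ->
  margX PX PY PZ T (type_distribution tau) i = (typeX tau i)%:R / n%:R.
Proof.
case/andP => /forallP tauL _; rewrite /margX /typeX natr_sum mulr_suml.
rewrite [RHS](bigID (fun v => (i, v.1, v.2) \in L)) /= [X in _ + X]big1 ?addr0 //.
by move=> v /(implyP (tauL _))/eqP ->; rewrite mul0r.
Qed.

Lemma margY_type tau j : type_on_L tau ->
  margY PX PY PZ T (type_distribution tau) j = (typeY tau j)%:R / n%:R.
Proof.
case/andP => /forallP tauL _; rewrite /margY /typeY natr_sum mulr_suml.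
rewrite [RHS](bigID (fun v => (v.1, j, v.2) \in L)) /= [X in _ + X]big1 ?addr0 //.
by move=> v /(implyP (tauL _))/eqP ->; rewrite mul0r.
Qed.

Lemma margZ_type tau k : type_on_L tau ->
  margZ PX PY PZ T (type_distribution tau) k = (typeZ tau k)%:R / n%:R.
Proof.
case/andP => /forallP tauL _; rewrite /margZ /typeZ natr_sum mulr_suml.
rewrite [RHS](bigID (fun v => (v.1, v.2, k) \in L)) /= [X in _ + X]big1 ?addr0 //.
by move=> v /(implyP (tauL _))/eqP ->; rewrite mul0r.
Qed.

Lemma card_type_classX tau : type_on_L tau ->
  #|type_class bX n (typeX tau)|%:R <= pX PX PY PZ T (type_distribution tau) ^+ n.
Proof.
move=> tauL; apply: le_trans (card_type_class _ _ _ n_gt0) _; rewrite le_eqVlt.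
apply/orP; left; apply/eqP; congr (_ ^+ _); apply: eq_bigr => i _.
rewrite margX_type //; congr ((_%:R / _) `^ _).
by apply: eq_card => x; rewrite inE PXE.
Qed.

Lemma card_type_classY tau : type_on_L tau ->
  #|type_class bY n (typeY tau)|%:R <= pY PX PY PZ T (type_distribution tau) ^+ n.
Proof.
move=> tauL; apply: le_trans (card_type_class _ _ _ n_gt0) _; rewrite le_eqVlt.
apply/orP; left; apply/eqP; congr (_ ^+ _); apply: eq_bigr => i _.
rewrite margY_type //; congr ((_%:R / _) `^ _).
by apply: eq_card => x; rewrite inE PYE.
Qed.

Lemma card_type_classZ tau : type_on_L tau ->
  #|type_class bZ n (typeZ tau)|%:R <= pZ PX PY PZ T (type_distribution tau) ^+ n.
Proof.
move=> tauL; apply: le_trans (card_type_class _ _ _ n_gt0) _; rewrite le_eqVlt.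
apply/orP; left; apply/eqP; congr (_ ^+ _); apply: eq_bigr => i _.
rewrite margZ_type //; congr ((_%:R / _) `^ _).
by apply: eq_card => x; rewrite inE PZE.
Qed.

Lemma block_type_ofE x y z l :
  block_type_of x y z l = #|[set t | (bX (x t), bY (y t), bZ (z t)) == l]%SET| :> nat.
Proof. by rewrite ffunE inordK // ltnS -[leqRHS]card_ord max_card. Qed.

Lemma block_type_of_on_L (x : {ffun 'I_n -> X}) (y : {ffun 'I_n -> Y}) (z : {ffun 'I_n -> Z}) :
  tensor_pow T n (x, y, z) != 0 -> type_on_L (block_type_of x y z).
Proof.
rewrite ffunE /= => /prodf_neq0 Tn0; apply/andP; split.
  apply/forallP => l; apply/implyP => lL; rewrite block_type_ofE cards_eq0.
  apply/set0Pn => -[t]; rewrite inE => /eqP tl.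
  by rewrite -tl mem_L // Tn0 in lL.
under eq_bigr do rewrite block_type_ofE.
rewrite -[X in _ == X]card_ord -cardsT.
rewrite (card_fiber (fun t => (bX (x t), bY (y t), bZ (z t)))).
by apply/eqP/eq_bigr => l _; apply: eq_card => t; rewrite !inE.
Qed.

Lemma mem_type_classX (x : {ffun 'I_n -> X}) y z :
  x \in type_class bX n (typeX (block_type_of x y z)).
Proof.
(* The positions with X-block [i] are sorted by their Y- and Z-blocks, which gives the joint counts
   summed in [typeX]. *)
rewrite inE; apply/forallP => i; rewrite (card_fiber (fun t => (bY (y t), bZ (z t)))).
apply/eqP/eq_bigr => -[j k] _; rewrite block_type_ofE; apply: eq_card => t.
by rewrite !inE -!pair_eqE /= /pair_eq /= -!pair_eqE /= -andbA.
Qed.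

Lemma mem_type_classY x (y : {ffun 'I_n -> Y}) z :
  y \in type_class bY n (typeY (block_type_of x y z)).
Proof.
rewrite inE; apply/forallP => j; rewrite (card_fiber (fun t => (bX (x t), bZ (z t)))).
apply/eqP/eq_bigr => -[i k] _; rewrite block_type_ofE; apply: eq_card => t.
by rewrite !inE -!pair_eqE /= /pair_eq /= -!pair_eqE /= andbCA andbA.
Qed.

Lemma mem_type_classZ x y (z : {ffun 'I_n -> Z}) :
  z \in type_class bZ n (typeZ (block_type_of x y z)).
Proof.
rewrite inE; apply/forallP => k; rewrite (card_fiber (fun t => (bX (x t), bY (y t)))).
apply/eqP/eq_bigr => -[i j] _; rewrite block_type_ofE; apply: eq_card => t.
by rewrite !inE -!pair_eqE /= /pair_eq /= -!pair_eqE /= andbC.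
Qed.

(** A union bound: the index condition caps each class at [B], and all types are counted, on [L] or
    not. *)
Lemma card_union_types_le (V : finType) (C : {ffun I -> 'I_n.+1} -> {set V}) (B : R) :
    0 <= B ->
  #|\bigcup_(tau | type_on_L tau && (#|C tau|%:R <= B)) C tau|%:R <=
    n.+1%:R ^+ (kX * kY * kZ) * B.
Proof.
move=> B0; pose P tau := type_on_L tau && (#|C tau|%:R <= B).
have le_sum : (#|\bigcup_(tau | P tau) C tau| <= \sum_(tau | P tau) #|C tau|)%N.
  exact: unstable.card_big_setU.
move: le_sum; rewrite -(ler_nat R) => /le_trans; apply.
apply: (@le_trans _ _ (\sum_(tau : {ffun I -> 'I_n.+1}) B)).
  by rewrite natr_sum big_mkcond; apply: ler_sum => tau _; case: ifP => // /andP[].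
by rewrite sumr_const card_ffun !card_prod !card_ord -natrX mulr_natl.
Qed.

Lemma slice_rank_pow_le :
  (slice_rank (tensor_pow T n))%:R <=
    3 * n.+1%:R ^+ (kX * kY * kZ) * sup (min_values (R := R) PX PY PZ T) ^+ n.
Proof.
set s := sup _.
have s0 : 0 <= s by exact: sup_min_values_ge0.
have sn0 : 0 <= s ^+ n by rewrite exprn_ge0.
(* Only the classes with at most [s ^+ n] elements are collected, separately for each of the three
   coordinates. *)
pose U (V : finType) (C : {ffun I -> 'I_n.+1} -> {set V}) :=
  (\bigcup_(tau | type_on_L tau && (#|C tau|%:R <= s ^+ n)) C tau)%SET.
pose A := U _ (fun tau => type_class bX n (typeX tau)).
pose B := U _ (fun tau => type_class bY n (typeY tau)).
pose C := U _ (fun tau => type_class bZ n (typeZ tau)).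
apply: (@le_trans _ _ (#|A| + #|B| + #|C|)%N%:R).
  rewrite ler_nat slice_rank_le_cover // => -[[x y] z] Txyz /=.
  have tauL := block_type_of_on_L Txyz.
  set tau := block_type_of _ _ _ in tauL.
  (* The frequencies [tau] form a distribution on [L], so one of its [pX], [pY], [pZ] is at most
     [s]; the class of that coordinate is among the collected ones. *)
  have := ub_le_sup (min_values_ubound R PX PY PZ T)
            (imageP _ (type_distributionP tauL)) : _ <= s.
  rewrite !ge_min => /or3P[] /(lerXn2r n) le_s; apply/or3P.
  - apply/Or31/finset.bigcupP; exists tau; last exact: mem_type_classX.
    by rewrite tauL (le_trans (card_type_classX tauL)) // le_s ?nnegrE ?prodr_ge0 // => i _; exact: powR_ge0.
  - apply/Or32/finset.bigcupP; exists tau; last exact: mem_type_classY.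
    by rewrite tauL (le_trans (card_type_classY tauL)) // le_s ?nnegrE ?prodr_ge0 // => i _; exact: powR_ge0.
  - apply/Or33/finset.bigcupP; exists tau; last exact: mem_type_classZ.
    by rewrite tauL (le_trans (card_type_classZ tauL)) // le_s ?nnegrE ?prodr_ge0 // => i _; exact: powR_ge0.
rewrite !natrD -mulrA mulr_natl mulrS mulr2n addrA.
by rewrite !lerD ?card_union_types_le.
Qed.

End SliceRankPower.

Theorem theorem4p4 (R : realType) (F : fieldType) (X Y Z : finType)
  (T : tensor F X Y Z) (hT : minimal_tensor T)
  (kX kY kZ : nat)
  (PX : 'I_kX -> {set X}) (hPX : is_indexed_partition PX)
  (PY : 'I_kY -> {set Y}) (hPY : is_indexed_partition PY)
  (PZ : 'I_kZ -> {set Z}) (hPZ : is_indexed_partition PZ) :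
  (asymptotic_slice_rank R T <= (sup (min_values (R := R) PX PY PZ T))%:E)%E.
Proof.
have [bX PXE] := partition_index hPX.
have [bY PYE] := partition_index hPY.
have [bZ PZE] := partition_index hPZ.
apply: (limn_esup_root_le (C := 3) (K := kX * kY * kZ)) => //.
  exact: sup_min_values_ge0.
by move=> n n_gt0; exact: (slice_rank_pow_le R T PXE PYE PZE n_gt0).
Qed.
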